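(* For any $M\in\mathbb{N}$ we have $$1+\frac{\log n-\log\log n}{n}<\beta_n\le\beta_{M,n}^*\le 1+\frac{\log(n+1)}{n+1}+\mathcal{O}\Big(\frac{1+\log M}{n+1}\Big).$$
   Context: Here $n\in\mathbb{N}=\{1,2,3,\ldots\}$, and $\mathcal{O}$ is the standard big $\mathcal{O}$ notation. For $n\in\mathbb{N}$, $\beta_n$ denotes the unique zero of $f_n(x)=x^{n+1}-x^n-1$ contained in the interval $(1,2)$. For $M\in\mathbb{N}$, $\beta\in(1,M+1]$ and $x\in[0,\frac{M}{\beta-1}]$, let $\Sigma_{\beta,M}(x)=\{(a_i)\in\{0,\ldots,M\}^{\mathbb{N}}:\sum_{i=1}^{\infty}\frac{a_i}{\beta^i}=x\}$. For $(a_i)\in\{0,\ldots,M\}^{\mathbb{N}}$ and $k\in\{0,\ldots,M\}$, let $\mathrm{freq}_k(a_i)=\lim_{N\to\infty}\frac{\#\{1\le i\le N:a_i=k\}}{N}$, assuming the limit exists. Let $\Delta_M=\{(p_k)_{k=0}^M\in\mathbb{R}^{M+1}:p_k\ge0,\ \sum_{k=0}^M p_k=1\}$; for $\epsilon>0$ let $\Delta_{M,\epsilon}=\{(p_k)_{k=0}^M\in\mathbb{R}^{M+1}:0\le p_k\le 1-\epsilon,\ \sum_{k=0}^M p_k=1\}$; and let $\Delta_{M,\beta}(x)$ be the set of $(p_k)\in\Delta_M$ for which there exists $(a_i)\in\Sigma_{\beta,M}(x)$ such that $\mathrm{freq}_k(a_i)=p_k$ for all $0\le k\le M$. For $M,n\in\mathbb{N}$,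 $$\beta_{M,n}^*=\sup\Big\{\beta^*:\ \forall\beta\in(1,\beta^* )\text{ we have }\Delta_{M,\frac{1}{n+1}}\subseteq\Delta_{M,\beta}(x)\ \ \forall x\in\Big(0,\frac{M}{\beta-1}\Big)\Big\}.$$
   Formalization: The first inequality 1+(log n − log log n)/n < β_n is claimed only for n ≥ 3: at n = 1 log log n is undefined, and at n = 2 it is false (left side ≈ 1.5298, β_2 ≈ 1.4656); the other two inequalities are for all n ≥ 1. *)

(* Defs.v *)
From mathcomp Require Import all_boot all_order all_algebra.
From mathcomp Require Import all_classical all_reals all_analysis.
From mathcomp Require Import ring lra.
Set Implicit Arguments.
Unset Strict Implicit.
Unset Printing Implicit Defensive.
Import Order.TTheory GRing.Theory Num.Theory.
Import numFieldNormedType.Exports.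
Local Open Scope classical_set_scope.
Local Open Scope ring_scope.

Definition f_ {R : realType} (n : nat) (x : R) : R := x ^+ n.+1 - x ^+ n - 1.

(* For n >= 1 this is the only zero of f_ n in ]1, 2[: see beta_P, beta_uniq.
   For n = 0 there is no such zero and the value is meaningless. *)
Definition beta_ {R : realType} (n : nat) : R :=
  get [set x : R | 1 < x < 2 /\ f_ n x = 0].

(* The sequence (a_i)_{i >= 1} is indexed from 0: a i stands for a_{i+1}. *)
Definition Sigma {R : realType} (beta : R) (M : nat) (x : R) :
    set (nat -> 'I_M.+1) :=
  [set a | series (fun i => (a i)%:R / beta ^+ i.+1) @ \oo --> x].

(* Existence of the limit is part of the predicate; the quotient at N = 0 is
   irrelevant. *)
Definition has_freq {R : realType} (M : nat) (a : nat -> 'I_M.+1)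
    (k : 'I_M.+1) (l : R) : Prop :=
  (fun N : nat => #|[set i : 'I_N | a i == k]%SET|%:R / N%:R : R) @ \oo --> l.

Definition Delta {R : realType} (M : nat) : set ('I_M.+1 -> R) :=
  [set p | (forall k, 0 <= p k) /\ \sum_(k < M.+1) p k = 1].

Definition Delta_eps {R : realType} (M : nat) (eps : R) :
    set ('I_M.+1 -> R) :=
  [set p | (forall k, 0 <= p k <= 1 - eps) /\ \sum_(k < M.+1) p k = 1].

Definition Delta_beta {R : realType} (M : nat) (beta x : R) :
    set ('I_M.+1 -> R) :=
  [set p | Delta p /\
     exists2 a, Sigma beta x a & forall k, has_freq a k (p k)].

(* sup is 0 on a set without upper bound.  For M, n >= 1 the set is bounded:
   Delta_eps is then nonempty, and for beta > M + 1 some x in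
   ]0, M / (beta - 1)[ has no expansion, so no b > M + 1 qualifies. *)
Definition beta_star {R : realType} (M n : nat) : R :=
  sup [set b : R | forall beta : R, 1 < beta < b ->
         forall x : R, 0 < x < M%:R / (beta - 1) ->
         Delta_eps (M := M) (n.+1%:R^-1) `<=` Delta_beta beta x].

Section beta_n.
Context {R : realType}.
Implicit Types (n : nat) (x y : R).

Lemma f_E n x : f_ n x = x ^+ n * (x - 1) - 1.
Proof. by rewrite /f_ exprSr mulrBr mulr1. Qed.

Lemma f_lt n x y : 1 < x -> x < y -> f_ n x < f_ n y.
Proof.
move=> x1 xy; rewrite !f_E ltrD2r.
have x0 : 0 < x by apply: lt_trans x1.
apply: (@le_lt_trans _ _ (y ^+ n * (x - 1))).
  apply: ler_wpM2r; first by rewrite subr_ge0 ltW.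
  by apply: lerXn2r; rewrite ?nnegrE ltW // (lt_trans x0).
by rewrite ltr_pM2l ?ltrD2r // exprn_gt0 // (lt_trans x0).
Qed.

Lemma f_zero n : (0 < n)%N -> exists x, 1 < x < 2 /\ f_ n x = 0.
Proof.
move=> n0.
have f1 : f_ n (1 : R) = -1 by rewrite f_E subrr mulr0 sub0r.
have f2 : 0 < f_ n (2 : R).
  have -> : f_ n (2 : R) = 2 ^+ n - 1 by rewrite f_E; ring.
  by rewrite subr_gt0 exprn_egt1 ?ltr1n // -lt0n.
have cf : continuous (f_ n : R -> R).
  move=> x; rewrite /f_; apply: cvgB; last exact: cvg_cst.
  by apply: cvgB; exact: exprn_continuous.
have [|||x] := @IVT R (f_ n) 1 2 0.
- by lra.
- exact: continuous_subspaceT.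
- by rewrite f1 ge_min le_max (ltW f2) orbT andbT; apply/orP; left; lra.
rewrite in_itv /= => /andP[x1 x2] fx; exists x; split => //.
rewrite !lt_neqAle x1 x2 !andbT; apply/andP; split; apply/eqP => xE.
  by move: fx; rewrite -xE f1; lra.
by move: fx f2; rewrite xE => ->; rewrite ltxx.
Qed.

Lemma beta_P n : (0 < n)%N ->
  1 < (beta_ n : R) < 2 /\ f_ n (beta_ n : R) = 0.
Proof. by move=> n0; exact: (getPex (f_zero n0)). Qed.

Lemma beta_uniq n x : (0 < n)%N -> 1 < x < 2 -> f_ n x = 0 -> x = beta_ n.
Proof.
move=> n0 /andP[x1 _] fx; have [/andP[b1 _] fb] := beta_P n0.
case: (ltgtP x (beta_ n)) => // h.
- by have := f_lt n x1 h; rewrite fx fb ltxx.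
- by have := f_lt n b1 h; rewrite fx fb ltxx.
Qed.

End beta_n.

(* Main.v *)
Require Import Defs.
From mathcomp Require Import all_boot all_order all_algebra.
From mathcomp Require Import all_classical all_reals all_analysis.
From mathcomp Require Import ring lra zify.
Import Order.TTheory GRing.Theory Num.Theory.
Import numFieldNormedType.Exports.
Local Open Scope ring_scope.

(** Fix a base b and put s = (b - 1) x.  Then x has an expansion with digits a_i
    exactly when the orbit of s under s -> d + b (s - d), with d running through
    the digits a_i, stays bounded; each digit d is the repelling fixed point of
    its own map, and the admissible region for s is [0, M].  An expansion is
    therefore the same thing as a way of steering s inside [0, M].

    Attaining frequencies for b < beta_n.  Let k and l be two digits, and let
    most of the digits be k.  A digit k multiplies the distance q of s from k by
    b; once q has become large, one digit l brings s back towards k.  On the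
    scale log_b q a digit k is a gain of one, and a digit l used at the right
    moment is a loss of at least n, because b ^ n (b - 1) < 1, that is
    f_n b < 0.  So an orbit can stay between k and l for ever with at least n
    digits k to each l, apart from a bounded error.
    Extended to a compact part of ]0, M[, the function log_b q becomes the
    Lyapunov function of [steer_lyap].

    The extreme points of the slice p_k <= n / (n + 1) of the simplex are the
    vectors with masses n / (n + 1) and 1 / (n + 1) on two digits, and a linear
    functional is minimal at one of them.  So [steer_functional] makes the sum
    of any linear functional over the chosen digits as small as its mean under
    p prescribes, up to a bounded error.  As in the approachability theorem of
    Blackwell, this suffices: freeze the vector F of count discrepancies at the
    times j ^ 2 and steer against F until (j + 1) ^ 2.  The squared discrepancy
    at time j ^ 2 is O(j ^ 3) and hence o(j ^ 4), so all frequencies converge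
    ([feedback_frequencies], [Delta_eps_attained]).

    Missing frequencies for large b.  Let w_k > 0 be weights with
    sum_k w_k < b prod_k w_k ^ p_k.  A word with frequencies p has a large
    product of weights, and there are too few words with so large a product for
    their cylinders to cover an interval; by Borel-Cantelli, almost no x has an
    expansion with frequencies p ([unattained_frequencies]).  Applied to
    p = (1 - e, 0, ..., 0, e) with e = 1 / (n + 1), this shows that the
    frequencies are not attained everywhere as soon as
    b > exp ((log (n + 1) + 2) / (n + 1)), and this bound expands to the stated
    one ([rare_digit_unattained], [expR_small_le]).

    The lower bound for beta_n is the evaluation of f_n at the given point
    through (1 + t) ^ n <= exp (n t). *)

Set Implicit Arguments.
Unset Strict Implicit.
Unset Printing Implicit Defensive.
Local Open Scope classical_set_scope.

(** * The logarithmic lower bound for beta_n *)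

(** From 1 - 1/6 <= exp (- 1/6) one gets e <= (6/5) ^ 6 = 2.985... *)
Lemma expR1_lt3 {R : realType} : expR 1 < 3 :> R.
Proof.
have h : expR 6^-1 <= 6 / 5 :> R.
  have := @expR_ge1Dx R (- 6^-1); rewrite expRN => /(ler_wpM2r (expR_ge0 6^-1)).
  by rewrite mulVf ?gt_eqF ?expR_gt0 //; lra.
have -> : 1 = 6^-1 * 6%:R :> R by rewrite mulVf.
rewrite expRM_natr; apply: (@le_lt_trans _ _ ((6 / 5) ^+ 6)); last by lra.
by rewrite lerXn2r ?nnegrE ?expR_ge0 //; lra.
Qed.

(** At t = (log n - log log n) / n one has exp (n t) = n / log n, hence
    (1 + t) ^ n t <= 1 - log log n / log n < 1, and f_n is increasing.  The
    assumption 3 <= n makes log log n positive. *)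
Lemma beta_gt_log {R : realType} (n : nat) : (3 <= n)%N ->
  1 + (ln n%:R - ln (ln n%:R)) / n%:R < beta_ n :> R.
Proof.
move=> n3; have n0 : (0 < n)%N by lia.
have nR : 3 <= n%:R :> R by rewrite ler_nat.
have np : 0 < n%:R :> R by lra.
set L : R := ln n%:R.
have L1 : 1 < L.
  by rewrite -ltr_expR lnK ?posrE //; apply: lt_le_trans expR1_lt3 nR.
have lL : 0 < ln L by rewrite ln_gt0.
set t := (L - ln L) / n%:R.
have lL2 : ln L < L by rewrite ln_sublinear //; lra.
have t0 : 0 < t by rewrite divr_gt0 // subr_gt0.
rewrite ltNge; apply/negP => h.
have [/andP[bn1 _] fb] := beta_P (R := R) n0.
have : 0 <= f_ n (1 + t).
  move: h; rewrite le_eqVlt => /orP[/eqP <-|h]; first by rewrite fb.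
  by rewrite -fb ltW // f_lt.
rewrite f_E addrAC subrr add0r subr_ge0; apply/negP; rewrite -ltNge.
apply: (@le_lt_trans _ _ (expR (t * n%:R) * t)).
  rewrite ler_wpM2r ?(ltW t0) // expRM_natr.
  rewrite lerXn2r ?nnegrE ?expR_ge0 ?expR_ge1Dx //.
  by lra.
have L0 : 0 < L by lra.
have [EL ElL] : expR L = n%:R /\ expR (ln L) = L by rewrite !lnK.
rewrite {1}/t divfK ?gt_eqF // expRD expRN EL ElL.
have -> : n%:R / L * t = (L - ln L) / L.
  by rewrite /t; field; rewrite !gt_eqF //; lra.
by rewrite ltr_pdivrMr; lra.
Qed.

(** * Steering an orbit *)

Section Moves.
Context {R : realType} {M : nat}.
Implicit Types (b s del : R) (d : 'I_M.+1).

(** The map x -> b x - d in the coordinate s = (b - 1) x, in which d is a fixed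
    point. *)
Definition step b s d : R := d%:R + b * (s - d%:R).

(** Subtracting del keeps the digit at distance at least del from s, so that
    the move it causes cannot be arbitrarily short. *)
Definition digit_below del s : 'I_M.+1 := inord (Num.truncn (s - del)).

Definition digit_above del s : 'I_M.+1 := rev_ord (digit_below del (M%:R - s)).

Lemma rev_ordE d : (rev_ord d)%:R = M%:R - d%:R :> R.
Proof. by rewrite /= subSS natrB // -ltnS. Qed.

(** By this symmetry, steering with l < k reduces to steering with k < l. *)
Lemma step_rev b s d : step b s (rev_ord d) = M%:R - step b (M%:R - s) d.
Proof. rewrite /step rev_ordE; ring. Qed.

Lemma step_below b del s : 1 < b -> 0 < del -> del <= s <= M%:R - del ->
  s + (b - 1) * del <= step b s (digit_below del s) <
    s + (b - 1) * (1 + del).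
Proof.
move=> b1 d0 /andP[ds sM]; have sd : 0 <= s - del by rewrite subr_ge0.
have /andP[t1 t2] := truncn_itv sd.
have tM : (Num.truncn (s - del) < M.+1)%N.
  rewrite -(ltr_nat R); apply: le_lt_trans t1 _.
  by rewrite -natr1; lra.
rewrite /step /digit_below inordK //.
move: t1 t2; rewrite -natr1; set t := _%:R => t1 t2.
by apply/andP; split; nra.
Qed.

Lemma step_above b del s : 1 < b -> 0 < del -> del <= s <= M%:R - del ->
  s - (b - 1) * (1 + del) < step b s (digit_above del s) <=
    s - (b - 1) * del.
Proof.
move=> b1 d0 sK; rewrite /digit_above step_rev.
have : del <= M%:R - s <= M%:R - del by lra.
by move=> /(step_below b1 d0); lra.
Qed.

End Moves.

(** Room for steering in base b.  When k is the frequent digit and l the rare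
    one, w = (l - k) (b - 1) is the natural length unit at k, and w Z is the
    position relative to k above which the digit l is no longer used.
    [margin_bZ] says that even at that position one digit l followed by n digits
    k leads no farther from k than before; [margin_del1] makes
    w Z <= (l - k) - del, so that the whole construction fits in
    [del, M - del]. *)
Record margins {R : realType} (b Z del : R) (n : nat) : Prop := Margins {
  margin_b : 1 < b;
  margin_Z : 1 < Z;
  margin_bZ : (b ^+ n.+1 - 1) * Z <= b ^+ n;
  margin_del : 0 < del;
  margin_delZ : b * del <= (b - 1) * (Z - 1);
  margin_del1 : (b - 1) * Z + del <= 1 }.

Section Strategy.
Context {R : realType} {M : nat} (b Z del : R) (n : nat).
Implicit Types (s : R) (k l d : 'I_M.+1).

(** Moving left from beyond w Z by less than (b - 1) (1 + del) leaves at least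
    this distance from k. *)
Definition inner_margin := (b - 1) * (Z - 1 - del).
Definition stride := (b - 1) * del.
(** An upper bound, valid for all k and l, for the number of steps that s can
    drift away from k before it has to come back. *)
Definition log_width := ln (M%:R * (b - 1) * Z / inner_margin) / ln b.

(** Drift away from k with the digit k, come back with the digit l when the
    next digit k would lead beyond w Z, and elsewhere walk towards that
    region by short moves.  A move from the left may jump over the region, but
    one from the right cannot. *)
Definition steer k l s : 'I_M.+1 :=
  let q := s - k%:R in let w := (l%:R - k%:R) * (b - 1) in
  if q < inner_margin then digit_below del s
  else if q * b <= w * Z then k
  else if q <= w * Z then l
  else digit_above del s.

(** The logarithmic term charges a digit l against n digits k.  The two linear
    terms pay H for each move of length at least stride outside the region, and
    the term for the left side is larger because such a move may end on the
    right side. *)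
Definition lyap k l (a H : R) s : R :=
  let q := s - k%:R in let w := (l%:R - k%:R) * (b - 1) in
  if q < inner_margin then H * (log_width + M%:R / stride + (M%:R - s) / stride)
  else if q <= w * Z then a * (ln (q / inner_margin) / ln b)
  else H * (log_width + s / stride).

Definition lyap_bound : R := log_width + M%:R / stride + M%:R / stride.

Context (mar : margins b Z del n).

Let basics : [/\ 0 < b, del <= inner_margin, 0 < inner_margin, 0 < stride
  & 0 < ln b].
Proof.
have [b1 Z1 _ d0 dZ _] := mar; rewrite /inner_margin /stride.
by split; rewrite ?ln_gt0 //; nra.
Qed.

Let kl1 k l : (k < l)%N -> (1 : R) <= l%:R - k%:R <= (M%:R : R).
Proof.
move=> kl; have : (l <= M)%N by rewrite -ltnS.
have k0 : 0 <= (k%:R : R) by [].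
by move: kl; rewrite -!(ler_nat R) -natr1; lra.
Qed.

Let mid_bounds k l s a H : (k < l)%N -> 0 <= a <= H ->
  inner_margin <= s - k%:R <= (l%:R - k%:R) * (b - 1) * Z ->
  0 <= a * (ln ((s - k%:R) / inner_margin) / ln b) <= H * log_width.
Proof.
have [b1 Z1 _ d0 dZ _] := mar; have [b0 kd k0 s0 lb0] := basics.
move=> kl /andP[a0 aH] /andP[q1 q2].
have q0 : 0 < s - k%:R by lra.
have L0 : 0 <= ln ((s - k%:R) / inner_margin) / ln b.
  by rewrite divr_ge0 ?(ltW lb0) // ln_ge0 // ler_pdivlMr // mul1r.
have /andP[l1 lM] := kl1 kl.
have P0 : 0 < (b - 1) * Z by rewrite mulr_gt0; lra.
rewrite mulr_ge0 //= ler_pM // /log_width.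
have W0 : 0 < M%:R * (b - 1) * Z by rewrite -mulrA mulr_gt0 //; lra.
rewrite ler_pM2r ?invr_gt0 // ler_ln ?posrE ?divr_gt0 //.
by rewrite ler_pM2r ?invr_gt0 //; apply: le_trans q2 _; nra.
Qed.

Let log_width_ge0 k l : (k < l)%N -> 0 <= log_width.
Proof.
have [b1 Z1 _ d0 dZ _] := mar; have [b0 kd k0 s0 lb0] := basics.
move=> kl; have /andP[l1 lM] := kl1 kl.
have := @mid_bounds k l (inner_margin + k%:R) 1 1 kl; rewrite addrK mul1r.
have -> : 0 <= (1 : R) <= 1 by lra.
rewrite lexx /= => /(_ isT).
have -> : inner_margin <= (l%:R - k%:R) * (b - 1) * Z.
  apply: (@le_trans _ _ ((b - 1) * Z)); first by rewrite /inner_margin; nra.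
  by rewrite -mulrA ler_peMl // mulr_ge0; lra.
by move=> /(_ isT); rewrite mul1r; lra.
Qed.

Lemma lyap_itv k l a H s : (k < l)%N -> 0 <= a <= H ->
  del <= s <= M%:R - del ->
  0 <= lyap k l a H s <= H * lyap_bound.
Proof.
have [b1 Z1 _ d0 dZ _] := mar; have [b0 kd k0 s0 lb0] := basics.
move=> kl aH /andP[s1 s2]; have H0 : 0 <= H by lra.
have Lam0 := log_width_ge0 kl.
have i0 : 0 < stride^-1 by rewrite invr_gt0.
have M0 : 0 <= M%:R / stride by rewrite divr_ge0 // ltW.
rewrite /lyap /lyap_bound; case: ifPn => [h|].
  have ? : 0 <= (M%:R - s) / stride <= M%:R / stride.
    by rewrite divr_ge0 ?ler_pM2r ?(ltW s0) //; lra.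
  by rewrite mulr_ge0 ?ler_wpM2l //; lra.
rewrite -leNgt => h; case: ifPn => [h'|_].
  have /andP[-> h2] /= := mid_bounds kl aH (introT andP (conj h h')).
  by apply: le_trans h2 _; rewrite ler_wpM2l //; lra.
have ? : 0 <= s / stride <= M%:R / stride.
  by rewrite divr_ge0 ?ler_pM2r ?(ltW s0) //; lra.
by rewrite mulr_ge0 ?ler_wpM2l //; lra.
Qed.

Let step_self s k : step b s k - k%:R = b * (s - k%:R).
Proof. rewrite /step; ring. Qed.

(** The decrease of the Lyapunov function pays for the cost c of each step, so
    that the total cost along an orbit is bounded.  The three bounds on c are
    exactly what the strategy can afford: a digit k must gain a to offset a rise
    by one on the logarithmic scale, a digit l may lose n a, and H covers the
    transitional moves. *)
Lemma steer_lyap k l a H (c : 'I_M.+1 -> R) s :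
  (k < l)%N -> 0 <= a <= H -> c k <= - a -> c l <= n%:R * a ->
  (forall d, c d <= H) -> del <= s <= M%:R - del ->
  let s' := step b s (steer k l s) in
  del <= s' <= M%:R - del /\
  c (steer k l s) + lyap k l a H s' <= lyap k l a H s.
Proof.
have [b1 Z1 bZ d0 dZ d1] := mar; have [b0 kd k0 s0 lb0] := basics.
move=> kl aH ck cl cH sK; have /andP[l1 lM] := kl1 kl.
have Lam0 := log_width_ge0 kl; have H0 : 0 <= H by lra.
have k_ge0 : 0 <= (k%:R : R) by [].
have l_leM : (l%:R : R) <= M%:R by rewrite ler_nat -ltnS.
have [sb sa] := (step_below b1 d0 sK, step_above b1 d0 sK).
have marginE : inner_margin + (b - 1) * (1 + del) = (b - 1) * Z.
  by rewrite /inner_margin; ring.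
have strideE : (b - 1) * del = stride by [].
pose w : R := (l%:R - k%:R) * (b - 1).
have w0 : b - 1 <= w by rewrite /w ler_peMl //; lra.
have wZ : w * Z <= (l%:R - k%:R) - del.
  have ld : 1 * del <= (l%:R - k%:R) * del by rewrite ler_pM2r.
  apply: (@le_trans _ _ ((l%:R - k%:R) * (1 - del))); last by lra.
  by rewrite /w -mulrA ler_wpM2l //; lra.
have P0 : (b - 1) * Z <= w * Z by rewrite ler_pM2r //; lra.
have cHV d V V' : V' + H <= V -> c d + V' <= V by have := cH d; lra.
have ge1 x : stride <= x -> H <= H * (x / stride).
  by move=> sx; rewrite ler_peMr // ler_pdivlMr // mul1r.
have Vlo u : u - k%:R < inner_margin ->
    lyap k l a H u = H * (log_width + M%:R / stride + (M%:R - u) / stride).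
  by rewrite /lyap => ->.
have Vmid u : inner_margin <= u - k%:R <= w * Z ->
    lyap k l a H u = a * (ln ((u - k%:R) / inner_margin) / ln b).
  by rewrite /lyap leNgt -/w => /andP[/negbTE -> ->].
have Vhi u : w * Z < u - k%:R -> lyap k l a H u = H * (log_width + u / stride).
  move=> h; have kq : inner_margin <= u - k%:R by lra.
  by rewrite /lyap -/w ltNge kq /= leNgt h.
have Vmid_le u : inner_margin <= u - k%:R <= w * Z ->
    lyap k l a H u <= H * log_width.
  by move=> h; rewrite Vmid //; have /andP[] := mid_bounds kl aH h.
move=> s'; rewrite {}/s' /steer -/w; case: ifPn => [h|].
  set s' := step b s _ in sb *.
  have K' : del <= s' <= M%:R - del by lra.
  split=> //; apply: cHV; rewrite (Vlo s) //.
  have HM := @ge1 (M%:R - s); have HM' : stride <= M%:R - s by lra.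
  have M0 : 0 <= H * (s' / stride).
    by rewrite mulr_ge0 // divr_ge0 ?(ltW s0) //; lra.
  have M1 : 0 <= H * ((M%:R - s') / stride).
    by rewrite mulr_ge0 // divr_ge0 ?(ltW s0) //; lra.
  have := HM HM'; have [h1|h1] := ltP (s' - k%:R) inner_margin.
    by rewrite (Vlo s') //; have := @ge1 (s' - s); lra.
  have [h2|h2] := leP (s' - k%:R) (w * Z); last by rewrite Vhi //; lra.
  by have := @Vmid_le s'; rewrite h1 h2 => /(_ isT); lra.
rewrite -leNgt => h1; case: ifPn => [h2|].
  have q_up : s - k%:R <= b * (s - k%:R) by rewrite ler_peMl //; lra.
  rewrite mulrC in h2.
  have K' : del <= step b s k <= M%:R - del by have := step_self s k; lra.
  split=> //; rewrite !Vmid ?step_self; [|lra|lra].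
  rewrite -mulrA lnM ?posrE ?divr_gt0 //; [|lra].
  by rewrite mulrDl divff ?lt0r_neq0 //; lra.
rewrite -ltNge => h2; case: ifPn => h3.
  have sE : step b s l - k%:R = b * (s - k%:R) - w by rewrite /step /w; ring.
  set s' := step b s l in sE *.
  set q := s - k%:R in h1 h2 h3 sE *.
  have q0 : 0 < q by lra.
  have bn0 : 0 < b ^+ n by rewrite exprn_gt0.
  (* One l undoes at least n steps of k: the inequality is linear in q, and
     margin_bZ is its case q = w Z. *)
  have q'le : b ^+ n * (b * q - w) <= q.
    have : (b ^+ n.+1 - 1) * q <= b ^+ n * w; last by rewrite exprS; lra.
    have bn1 : 0 <= b ^+ n.+1 - 1 by rewrite subr_ge0 exprn_ege1 // ltW.
    apply: (@le_trans _ _ ((b ^+ n.+1 - 1) * Z * w)); last first.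
      by rewrite ler_wpM2r //; lra.
    by rewrite -mulrA ler_wpM2l // mulrC.
  have q'inner_margin : inner_margin <= b * q - w.
    have wZ1 : (b - 1) * (Z - 1) <= w * (Z - 1) by rewrite ler_pM2r //; lra.
    by rewrite /inner_margin; lra.
  have q'q : b * q - w <= q.
    by apply: le_trans q'le; rewrite ler_peMl ?exprn_ege1 // ?ltW //; lra.
  split; first lra.
  rewrite !Vmid ?sE -/q ?q'inner_margin ?h1 ?h3 ?(le_trans q'q h3) //.
  have : ln ((b * q - w) / inner_margin) / ln b <=
      ln (q / inner_margin) / ln b - n%:R.
    rewrite ler_pdivrMr // [leRHS]mulrBl (divfK (lt0r_neq0 lb0)).
    rewrite lerBrDl mulr_natl -lnXn // -lnM ?posrE ?divr_gt0 //; try lra.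
    rewrite ler_ln ?posrE ?mulr_gt0 ?divr_gt0 ?invr_gt0 //; try lra.
    by rewrite mulrA ler_pM2r ?invr_gt0.
  by case/andP: aH => a0 _ /(ler_wpM2l a0); lra.
(* Beyond w Z the move to the left is too short to jump over the region, by
   marginE. *)
rewrite -ltNge in h3.
set s' := step b s _ in sa *.
have K' : del <= s' <= M%:R - del by lra.
split=> //; apply: cHV; rewrite (Vhi s) //.
have [h4|h4] := leP (s' - k%:R) (w * Z); last first.
  by rewrite (Vhi s') //; have := @ge1 (s - s'); lra.
have h5 : inner_margin <= s' - k%:R by rewrite /inner_margin; nra.
have := @Vmid_le s'; rewrite h4 h5 => /(_ isT).
by have := @ge1 s; lra.
Qed.

End Strategy.

Lemma sum_indicator {R : realType} {M : nat} (i : 'I_M) (v : 'I_M -> R) :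
  \sum_k (k == i)%:R * v k = v i.
Proof.
rewrite (bigD1 i) //= eqxx mul1r big1 ?addr0 // => k /negbTE ->.
by rewrite mul0r.
Qed.

Section Control.
Context {R : realType} {M : nat} (b Z del : R) (n : nat).
Context (mar : margins b Z del n).
Implicit Types (s : R) (k l d : 'I_M.+1).

Let K s := del <= s <= M%:R - del.
Let C := lyap_bound (M := M) b Z del.

(** For l < k the strategy is the mirror image. *)
Lemma steer_pair k l a H (c : 'I_M.+1 -> R) :
  k != l -> 0 <= a <= H -> c k <= - a -> c l <= n%:R * a ->
  (forall d, c d <= H) ->
  exists g V, forall s, K s ->
    [/\ 0 <= V s <= H * C, K (step b s (g s)) &
     c (g s) + V (step b s (g s)) <= V s].
Proof.
move=> kl aH ck cl cH.
have [lt_kl|lt_lk|/val_inj/eqP] := ltngtP k l; last by rewrite (negbTE kl).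
  exists (steer b Z del k l), (lyap b Z del k l a H) => s Ks.
  have [Ks' dV] := steer_lyap mar lt_kl aH ck cl cH Ks.
  by split => //; exact: (lyap_itv mar).
have lt_rev : (rev_ord k < rev_ord l)%N.
  by rewrite /= !subSS ltn_sub2l //; have := ltn_ord k; lia.
exists (fun s => rev_ord (steer b Z del (rev_ord k) (rev_ord l) (M%:R - s))).
exists (fun s => lyap b Z del (rev_ord k) (rev_ord l) a H (M%:R - s)) => s Ks.
have Kr : K (M%:R - s) by move: Ks; rewrite /K; lra.
have [] := @steer_lyap R M _ _ _ _ mar _ _ a H (c \o @rev_ord _) _ lt_rev aH
  _ _ _ Kr.
- by rewrite /= rev_ordK.
- by rewrite /= rev_ordK.
- by move=> d /=.
move=> Ks' dV; rewrite step_rev subKr; split => //.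
  exact: (lyap_itv mar).
by move: Ks'; rewrite /K; lra.
Qed.

(** On the slice p_k <= n / (n + 1) of the simplex, the functional F is smallest
    at a point with masses n / (n + 1) on a minimiser k of F and 1 / (n + 1) on
    a minimiser l of F among the other digits; m is its value there.  Steering
    with this pair keeps the mean of F below m, up to a bounded error. *)
Lemma steer_functional (p F : 'I_M.+1 -> R) : (0 < M)%N ->
  (forall k, 0 <= p k <= 1 - n.+1%:R^-1) -> \sum_k p k = 1 ->
  exists g V, forall s, K s ->
    [/\ 0 <= V s <= 2 * C * \sum_k `|F k|, K (step b s (g s)) &
     F (g s) - \sum_k p k * F k + V (step b s (g s)) <= V s].
Proof.
move=> M0 p01 p1.
pose k := [arg min_(i < ord0) F i]%O.
have kmin d : F k <= F d by rewrite /k; case: arg_minP => // i _; apply.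
have [l0 l0k] : exists l0 : 'I_M.+1, l0 != k.
  case: (eqVneq k ord0) => [->|kn0]; last by exists ord0; rewrite eq_sym.
  by exists ord_max; rewrite -val_eqE /= -lt0n.
pose l := [arg min_(i < l0 | i != k) F i]%O.
have [lk lmin] : l != k /\ forall d, d != k -> F l <= F d.
  by rewrite /l; case: arg_minP.
set e : R := n.+1%:R^-1 in p01.
have n0 : 0 < n.+1%:R :> R by [].
have e0 : 0 < e by rewrite invr_gt0.
have e1 : e <= 1 by rewrite invf_le1 // ler1n.
have en : n%:R * e = 1 - e.
  by have := mulfV (lt0r_neq0 n0); rewrite -/e -natr1 mulrDl mul1r; lra.
set W := \sum_k `|F k|.
have FW d : `|F d| <= W.
  by rewrite /W (bigD1 d) //= lerDl sumr_ge0.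
pose m := F k + e * (F l - F k).
have klF : 0 <= F l - F k by rewrite subr_ge0.
have Fm : m <= \sum_i p i * F i.
  have -> : \sum_i p i * F i = F k + \sum_i p i * (F i - F k).
    under [in RHS]eq_bigr do rewrite mulrBr.
    by rewrite sumrB -mulr_suml p1 mul1r addrC subrK.
  rewrite lerD2l (bigD1 k) //= subrr mulr0 add0r.
  apply: (@le_trans _ _ (\sum_(i | i != k) p i * (F l - F k))).
    rewrite -mulr_suml ler_wpM2r //.
    move: p1; rewrite (bigD1 k) //=; have := p01 k; lra.
  apply: ler_sum => i ik; have /andP[pi0 _] := p01 i.
  by rewrite ler_wpM2l // lerD2r lmin.
have [|||||g [V gV]] :=
  @steer_pair k l (e * (F l - F k)) (2 * W) (fun d => F d - m).
- by rewrite eq_sym.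
- have := FW k; have := FW l; rewrite !ler_norml; nra.
- by rewrite /m; lra.
- by rewrite mulrA en /m; lra.
- move=> d; have := FW d; have := FW k; rewrite !ler_norml /m; nra.
exists g, V => s /gV[V0 Ks' dV]; split => //; last by lra.
by rewrite mulrAC.
Qed.

End Control.

(** The value of Z is the largest one that [margin_bZ] allows; that it exceeds 1
    is a reformulation of f_n b < 0. *)
Lemma margins_exist {R : realType} (b s : R) (n M : nat) : (0 < n)%N ->
  1 < b -> f_ n b < 0 -> 0 < s < M%:R ->
  exists Z del, margins b Z del n /\ del <= s <= M%:R - del.
Proof.
move=> n0 b1; rewrite /f_ => fb /andP[s0 sM].
have bn1 : 1 < b ^+ n by rewrite exprn_egt1 // -lt0n.
have bS : b ^+ n.+1 = b * b ^+ n by rewrite exprS.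
have Q0 : 0 < b ^+ n.+1 - 1 by rewrite bS; nra.
pose Z := b ^+ n / (b ^+ n.+1 - 1).
have ZQ : (b ^+ n.+1 - 1) * Z = b ^+ n.
  by rewrite mulrC divfK // lt0r_neq0.
have Z1 : 1 < Z by rewrite ltr_pdivlMr //; lra.
have bZ : (b - 1) * Z < 1.
  by rewrite mulrA ltr_pdivrMr // bS; lra.
have c0 : 0 < (b - 1) * (Z - 1) / b.
  by rewrite divr_gt0 ?mulr_gt0 //; lra.
pose del := Num.min (Num.min s (M%:R - s))
  (Num.min ((b - 1) * (Z - 1) / b) (1 - (b - 1) * Z)).
have [d1 d2 d3 d4] : [/\ del <= s, del <= M%:R - s,
    del <= (b - 1) * (Z - 1) / b & del <= 1 - (b - 1) * Z].
  by rewrite /del; split; rewrite !ge_min lexx ?orbT.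
exists Z, del; split; last lra.
split => //; first by rewrite ZQ.
- by rewrite /del !lt_min s0 c0 !subr_gt0 sM bZ.
- by move: d3; rewrite ler_pdivlMr ?(mulrC b) //; lra.
- lra.
Qed.

(** * Frequencies from feedback *)

Lemma sqrt_between (t : nat) : exists j, (j * j <= t < j.+1 * j.+1)%N.
Proof.
elim: t => [|t [j /andP[h1 h2]]]; first by exists 0%N.
have [h|h] := ltnP t.+1 (j.+1 * j.+1); first by exists j; lia.
by exists j.+1; lia.
Qed.

(** The following construction is independent of expansions: T is any controlled
    system and, for each vector F, the rule g F keeps the partial sums of F over
    the chosen digits below those of its mean under p, up to an error bounded by
    the size of F. *)
Section Feedback.
Context {R : realType} {M : nat} {S : Type}.
Context (T : S -> 'I_M.+1 -> S) (g : ('I_M.+1 -> R) -> S -> 'I_M.+1).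
Context (p : 'I_M.+1 -> R) (s0 : S).
Implicit Types (t i j : nat) (k d : 'I_M.+1).

Definition is_square t := [exists j : 'I_t.+1, j * j == t]%N.

(** The current point, the gap between digit counts and their targets t p_k, and
    the gap at the last square time before t, against which the rule steers.
    Changing the rule costs an error of the order of the gap, so that it must
    happen rarely; steering against an outdated gap costs the square of the
    waiting time.  Square times balance the two. *)
Fixpoint feedback t : S * ('I_M.+1 -> R) * ('I_M.+1 -> R) :=
  if t is t'.+1 then
    let: (s, D, F0) := feedback t' in
    let F := if is_square t' then D else F0 in
    let d := g F s in
    (T s d, fun k => D k + ((d == k)%:R - p k), F)
  else (s0, fun=> 0, fun=> 0).

Definition fb_point t := (feedback t).1.1.
Definition fb_gap t := (feedback t).1.2.
Definition fb_target t := if is_square t then fb_gap t else (feedback t).2.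
Definition fb_digit t := g (fb_target t) (fb_point t).

Lemma fb_pointS t : fb_point t.+1 = T (fb_point t) (fb_digit t).
Proof.
rewrite /fb_digit /fb_target /fb_point /fb_gap /=.
by case: (feedback t) => [[]].
Qed.

Lemma fb_gapS t k : fb_gap t.+1 k = fb_gap t k + ((fb_digit t == k)%:R - p k).
Proof.
rewrite /fb_digit /fb_target /fb_point /fb_gap /=.
by case: (feedback t) => [[]].
Qed.

Lemma feedback2S t : (feedback t.+1).2 = fb_target t.
Proof.
rewrite /fb_target /fb_gap /=.
by case: (feedback t) => [[]].
Qed.

Lemma fb_target_stage j i : (i <= 2 * j)%N ->
  fb_target (j * j + i) = fb_gap (j * j).
Proof.
elim: i => [_|i IH ij].
  rewrite addn0 /fb_target; case: ifPn => // /existsPn/(_ (inord j)).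
  by rewrite inordK ?eqxx //; nia.
rewrite addnS {1}/fb_target ifN ?feedback2S ?IH ?(ltnW ij) //.
by apply/existsPn => -[q /= _]; apply/eqP => qE; have [h|h] := leqP q j; nia.
Qed.

Lemma fb_gapE t k :
  fb_gap t k = #|[set i : 'I_t | fb_digit i == k]%SET|%:R - t%:R * p k.
Proof.
elim: t => [|t IH].
  by rewrite eq_card0 ?mul0r ?subr0 // => -[].
rewrite fb_gapS IH -natr1 -!sum1dep_card [in RHS]big_mkcond big_ord_recr /=.
rewrite -big_mkcond /= natrD; case: (_ == k) => /=; ring.
Qed.

Context (Kp : S -> Prop) (C : R) (V : ('I_M.+1 -> R) -> S -> R).
Context (C_ge0 : 0 <= C) (p01 : forall k, 0 <= p k <= 1) (K0 : Kp s0).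
Context (gV : forall F s, Kp s ->
  [/\ 0 <= V F s <= C * \sum_k `|F k|, Kp (T s (g F s)) &
   F (g F s) - \sum_k p k * F k + V F (T s (g F s)) <= V F s]).

Lemma fb_point_inv t : Kp (fb_point t).
Proof.
elim: t => [|t IH]; first exact: K0.
by rewrite fb_pointS; have [] := gV (fb_target t) IH.
Qed.

Lemma fb_gap_lip t i k : `|fb_gap (t + i) k - fb_gap t k| <= i%:R.
Proof.
elim: i => [|i IH]; first by rewrite addn0 subrr normr0.
rewrite addnS fb_gapS -natr1; set e := _%:R - p k.
rewrite (_ : _ - _ = (fb_gap (t + i) k - fb_gap t k) + e); last by ring.
apply: le_trans (ler_normD _ _) _; rewrite lerD //.
by rewrite ler_norml /e; have := p01 k; case: (_ == k) => /=; lra.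
Qed.

Lemma fb_gap_le t k : `|fb_gap t k| <= t%:R.
Proof. by have := @fb_gap_lip 0 t k; rewrite add0n subr0. Qed.

(** Within a stage the vector F is constant, and the drift conditions telescope
    to a bound on the inner product of F with the growth of the gap. *)
Lemma fb_drift j i : (i <= (2 * j).+1)%N ->
  let F := fb_gap (j * j) in
  \sum_k F k * (fb_gap (j * j + i) k - F k) + V F (fb_point (j * j + i)) <=
  V F (fb_point (j * j)).
Proof.
rewrite /=; set F := fb_gap (j * j); elim: i => [_|i IH ij].
  by rewrite addn0 big1 ?add0r // => k _; rewrite subrr mulr0.
apply: le_trans (IH (ltnW ij)); rewrite addnS fb_pointS.
have [_ _] := gV F (fb_point_inv (j * j + i)).
have -> : g F (fb_point (j * j + i)) = fb_digit (j * j + i).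
  by rewrite /fb_digit fb_target_stage.
set d := fb_digit _; set s' := T _ _.
have -> : \sum_k F k * (fb_gap (j * j + i).+1 k - F k) =
  \sum_k F k * (fb_gap (j * j + i) k - F k) + (F d - \sum_k p k * F k).
  rewrite -{1}(sum_indicator d F).
  rewrite -sumrB -big_split /=; apply: eq_bigr => k _.
  rewrite fb_gapS -/d (eq_sym d); ring.
by lra.
Qed.

Let B : R := M.+1%:R * (2 * C + 4).

(** Let F be the gap at time j ^ 2 and X its growth during the stage.  In
    |F + X|^2 = |F|^2 + 2 <F, X> + |X|^2 the inner product is at most a constant
    times |F|, for which the trivial bound O(j ^ 2) is enough, and |X| is at
    most of the order of the length 2 j + 1 of the stage.  Each stage thus adds
    O(j ^ 2). *)
Lemma fb_gap_sq j : \sum_k fb_gap (j * j) k ^+ 2 <= B * j%:R ^+ 3.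
Proof.
have M0 : 0 <= M.+1%:R :> R by [].
elim: j => [|j IH].
  rewrite big1 ?expr0n ?mulr0 // => k _.
  by rewrite /fb_gap /= expr0n.
set F := fb_gap (j * j) in IH *.
have tE : (j.+1 * j.+1 = j * j + (2 * j).+1)%N by lia.
have := @fb_drift j _ (leqnn _); rewrite -tE -/F /=.
set D := fb_gap _; set X := \sum_k _ * _ => hX.
have [/andP[_ V1] _ _] := gV F (fb_point_inv (j * j)).
have [/andP[V0 _] _ _] := gV F (fb_point_inv (j.+1 * j.+1)).
have j0 : 0 <= j%:R :> R by [].
have F1 : \sum_k `|F k| <= M.+1%:R * (j%:R * j%:R).
  rewrite mulr_natl -[X in _ *+ X](card_ord M.+1) -sumr_const.
  by apply: ler_sum => k _; rewrite -natrM fb_gap_le.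
have DF : \sum_k (D k - F k) ^+ 2 <= M.+1%:R * (2 * j%:R + 1) ^+ 2.
  rewrite [leRHS]mulr_natl -[X in _ *+ X](card_ord M.+1) -sumr_const.
  apply: ler_sum => k _; rewrite -[leLHS]real_normK ?num_real //.
  rewrite ler_sqr ?nnegrE ?addr_ge0 ?mulr_ge0 //.
  have := @fb_gap_lip (j * j) (2 * j).+1 k.
  by rewrite -tE -natr1 natrM.
have -> : \sum_k D k ^+ 2 =
  \sum_k F k ^+ 2 + 2 * X + \sum_k (D k - F k) ^+ 2.
  by rewrite mulr_sumr -!big_split; apply: eq_bigr => k _ /=; ring.
have CF : C * \sum_k `|F k| <= C * (M.+1%:R * (j%:R * j%:R)).
  by rewrite ler_wpM2l.
have X1 : X <= C * (M.+1%:R * (j%:R * j%:R)) by lra.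
rewrite -natr1 /B in IH *.
set m := M.+1%:R in M0 IH X1 DF *; set x := j%:R in j0 IH X1 DF *.
have mC : 0 <= m * C by rewrite mulr_ge0.
have : 0 <= (m * C) * x /\ 0 <= m * x /\ 0 <= m * C * x * x /\ 0 <= m * x * x.
  by rewrite !mulr_ge0.
by lra.
Qed.

(** For j ^ 2 <= t < (j + 1) ^ 2 the squared gap is O(j ^ 3), while t ^ 2 is at
    least j ^ 4. *)
Lemma fb_freq k : has_freq fb_digit k (p k).
Proof.
rewrite /has_freq; apply/cvgrPdist_le => e e0.
pose B' := 2 * B + 8.
have B0 : 0 <= B by rewrite /B mulr_ge0 // addr_ge0 // mulr_ge0.
pose J := (Num.truncn (B' / e ^+ 2)).+1.
exists (J * J)%N => // t /= Jt.
have [j /andP[jt tj]] := sqrt_between t.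
have Jj : (J <= j)%N by nia.
have j1 : 1 <= j%:R :> R by rewrite ler1n; lia.
have t0 : 0 < t%:R :> R by rewrite ltr0n; nia.
have cE : #|[set i : 'I_t | fb_digit i == k]%SET|%:R = fb_gap t k + t%:R * p k.
  by rewrite fb_gapE; ring.
rewrite cE mulrDl mulrAC divff ?gt_eqF // mul1r distrC addrK.
rewrite normf_div (gtr0_norm t0) ler_pdivrMr //.
have jtR : j%:R * j%:R <= t%:R :> R by rewrite -natrM ler_nat.
suff : `|fb_gap t k| ^+ 2 <= (e * t%:R) ^+ 2.
  by rewrite ler_sqr ?nnegrE ?mulr_ge0 // ltW.
rewrite real_normK ?num_real //.
have D1 : fb_gap (j * j) k ^+ 2 <= B * j%:R ^+ 3.
  apply: le_trans (fb_gap_sq j); rewrite (bigD1 k) //= lerDl.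
  by rewrite sumr_ge0 // => d _; rewrite sqr_ge0.
have D2 : (fb_gap t k - fb_gap (j * j) k) ^+ 2 <= (2 * j%:R) ^+ 2.
  rewrite -real_normK ?num_real // ler_sqr ?nnegrE ?mulr_ge0 //.
  have := @fb_gap_lip (j * j) (t - j * j) k; rewrite subnKC // => h.
  by apply: le_trans h _; rewrite -natrM ler_nat; lia.
have D3 : fb_gap t k ^+ 2 <= B' * j%:R ^+ 3.
  set u := fb_gap t k in D2 *; set v := fb_gap (j * j) k in D1 D2.
  have : u ^+ 2 <= 2 * v ^+ 2 + 2 * (u - v) ^+ 2.
    by have := sqr_ge0 (u - 2 * v); lra.
  have : j%:R ^+ 2 <= j%:R ^+ 3 :> R by rewrite [leRHS]exprS ler_peMl ?sqr_ge0.
  by rewrite /B'; lra.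
apply: le_trans D3 _; rewrite exprMn.
have e2 : 0 < e ^+ 2 by rewrite exprn_gt0.
have BJ : B' <= e ^+ 2 * j%:R.
  rewrite mulrC -ler_pdivrMr //; apply: (@le_trans _ _ J%:R).
    by rewrite ltW // truncnS_gt.
  by rewrite ler_nat.
have j3 : 0 <= j%:R ^+ 3 :> R by rewrite exprn_ge0 //; lra.
apply: (@le_trans _ _ (e ^+ 2 * j%:R * j%:R ^+ 3)); first by rewrite ler_wpM2r.
rewrite -mulrA ler_wpM2l ?(ltW e2) //.
rewrite (_ : _ * _ = (j%:R * j%:R) ^+ 2); last by ring.
by rewrite ler_sqr ?nnegrE.
Qed.

End Feedback.

Lemma feedback_frequencies {R : realType} {M : nat} {S : Type}
    (T : S -> 'I_M.+1 -> S) (p : 'I_M.+1 -> R) (Kp : S -> Prop) (C : R)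
    (s0 : S) :
  0 <= C -> (forall k, 0 <= p k <= 1) -> Kp s0 ->
  (forall F : 'I_M.+1 -> R, exists g V, forall s, Kp s ->
    [/\ 0 <= V s <= C * \sum_k `|F k|, Kp (T s (g s)) &
     F (g s) - \sum_k p k * F k + V (T s (g s)) <= V s]) ->
  exists a pt, [/\ pt 0%N = s0, forall t, pt t.+1 = T (pt t) (a t),
    forall t, Kp (pt t) & forall k, has_freq a k (p k)].
Proof.
move=> C0 p01 K0 /choice[g /choice[V gV]].
exists (fb_digit T g p s0), (fb_point T g p s0); split => //.
- exact: fb_pointS.
- by move=> t; apply: (fb_point_inv (Kp := Kp) (C := C) (V := V)).
- by move=> k; apply: (fb_freq (Kp := Kp) (C := C) (V := V)).
Qed.

(** * From orbits to expansions *)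

(** The partial sums of the series differ from x by pt N / ((b - 1) b ^ N). *)
Lemma orbit_expansion {R : realType} {M : nat} (b x : R) (a : nat -> 'I_M.+1)
    (pt : nat -> R) : 1 < b ->
  pt 0%N = (b - 1) * x -> (forall t, pt t.+1 = step b (pt t) (a t)) ->
  (forall t, 0 <= pt t <= M%:R) -> Sigma b x a.
Proof.
move=> b1 pt0 ptS ptM; rewrite /Sigma /=.
have b0 : 0 < b by lra.
have bB : b - 1 != 0 by rewrite subr_eq0 gt_eqF.
have seriesE N : series (fun i => (a i)%:R / b ^+ i.+1) N =
    x - pt N / (b - 1) * b^-1 ^+ N.
  elim: N => [|N IH].
    by rewrite /series /= big_geq // pt0 expr0 mulr1 mulrC mulKf ?subrr.
  rewrite /series /= big_nat_recr //= -/(series _ N) [X in X + _]IH ptS /step.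
  rewrite !exprVn; have bN : b ^+ N != 0 by rewrite expf_neq0 // gt_eqF.
  by rewrite exprS; field; rewrite bB bN gt_eqF.
have geo : (fun N : nat => x - M%:R / (b - 1) * b^-1 ^+ N) @ \oo --> x.
  rewrite -[X in _ --> X](subr0 x) -[X in x - X](mulr0 (M%:R / (b - 1))).
  apply: cvgB; first exact: cvg_cst.
  apply: cvgM; first exact: cvg_cst.
  apply: cvg_expr; rewrite ger0_norm ?invr_ge0 ?ltW //.
  by rewrite invf_lt1.
apply: (squeeze_cvgr _ geo (cvg_cst x)).
apply: nearW => N; rewrite seriesE.
have /andP[p0 pM] := ptM N.
have i0 : 0 <= b^-1 ^+ N by rewrite exprn_ge0 // invr_ge0 ltW.
have bi : 0 <= (b - 1)^-1 by rewrite invr_ge0; lra.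
apply/andP; split.
  by rewrite lerD2l lerN2 ler_wpM2r // ler_wpM2r.
by rewrite gerBl mulr_ge0 // mulr_ge0.
Qed.

Lemma Delta_eps_attained {R : realType} (M n : nat) (b x : R) :
  (0 < M)%N -> (0 < n)%N -> 1 < b < beta_ n -> 0 < x < M%:R / (b - 1) ->
  Delta_eps (M := M) (n.+1%:R^-1) `<=` Delta_beta b x.
Proof.
move=> M0 n0 /andP[b1 bn] /andP[x0 xM] p [p01 p1].
have i0 : 0 < n.+1%:R^-1 :> R by [].
split; first by split=> // k; case/andP: (p01 k).
have bB : 0 < b - 1 by rewrite subr_gt0.
have fb : f_ n b < 0 by have [_ <-] := beta_P (R := R) n0; exact: f_lt.
have sM : 0 < (b - 1) * x < M%:R.
  by rewrite mulr_gt0 //= mulrC -ltr_pdivlMr.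
have [Z [del [mar Ks]]] := margins_exist n0 b1 fb sM.
have C0 : 0 <= 2 * lyap_bound (M := M) b Z del.
  have kl : ((ord0 : 'I_M.+1) < (ord_max : 'I_M.+1))%N by [].
  have h01 : 0 <= (0 : R) <= 1 by lra.
  by have := lyap_itv mar kl h01 Ks; lra.
have p01' k : 0 <= p k <= 1.
  by have /andP[-> h] := p01 k; apply: le_trans h _; rewrite gerBl ltW.
have [|a [pt [pt0 ptS ptK ptf]]] := feedback_frequencies
    (T := step b) (Kp := fun s => del <= s <= M%:R - del) C0 p01' Ks.
  by move=> F; exact: (steer_functional mar F M0 p01 p1).
exists a => //; apply: (orbit_expansion b1 pt0 ptS) => t.
by have := ptK t; have := margin_del mar; lra.
Qed.

(** * Almost no point has an expansion with low-entropy frequencies *)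

Lemma measure_bigsetU_le {d} {T : ringOfSetsType d} {R : realFieldType}
    (mu : {content set T -> \bar R}) (I : Type) (r : seq I) (P : pred I)
    (F : I -> set T) : (forall i, P i -> measurable (F i)) ->
  (mu (\big[setU/set0]_(i <- r | P i) F i) <= \sum_(i <- r | P i) mu (F i))%E.
Proof.
move=> mF; elim: r => [|i r IH]; first by rewrite !big_nil measure0.
rewrite !big_cons; case: ifPn => // Pi.
have mU := @bigsetU_measurable _ _ _ r P F mF.
by apply: le_trans (measureU2 mu (mF i Pi) mU) _; rewrite leeD2l.
Qed.

(** The mean of v along a is the sum of v weighted by the empirical
    frequencies. *)
Lemma cvg_freq_mean {R : realType} {M : nat} (a : nat -> 'I_M.+1)
    (p v : 'I_M.+1 -> R) : (forall k, has_freq a k (p k)) ->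
  (fun N : nat => (\sum_(i < N) v (a i)) / N%:R) @ \oo --> \sum_k p k * v k.
Proof.
move=> ap; have -> : (fun N : nat => (\sum_(i < N) v (a i)) / N%:R) =
    (fun N : nat => \sum_k #|[set i : 'I_N | a i == k]%SET|%:R / N%:R * v k).
  apply/funext => N; rewrite (partition_big (fun i : 'I_N => a i) predT) //=.
  rewrite mulr_suml; apply: eq_bigr => k _.
  rewrite (eq_bigr (fun=> v k)) => [|i /eqP -> //].
  by rewrite sumr_const -(mulr_natl (v k)) cardsE mulrAC.
apply: (cvg_big (op := +%R)) => [|k _]; first exact: add_continuous.
by apply: cvgM; [exact: ap | exact: cvg_cst].
Qed.

Section Cover.
Context {R : realType} {M : nat} (b : R) (w : 'I_M.+1 -> R) (lam : R).
Context (b_gt1 : 1 < b) (w_gt0 : forall k, 0 < w k) (lam_gt0 : 0 < lam).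
Implicit Type N : nat.

Definition word_value N (t : 'I_M.+1 ^ N) : R :=
  \sum_(i < N) (t i)%:R / b ^+ i.+1.

(** All expansions that begin with the word t have their sum in this
    interval. *)
Definition cylinder N (t : 'I_M.+1 ^ N) : set R :=
  `[word_value t, word_value t + M%:R / (b - 1) / b ^+ N].

Definition heavy_cover N : set R :=
  \big[setU/set0]_(t : 'I_M.+1 ^ N | lam ^+ N <= \prod_i w (t i)) cylinder t.

Lemma measurable_heavy_cover N : measurable (heavy_cover N).
Proof. by apply: bigsetU_measurable => t _; exact: measurable_itv. Qed.

(** The condition prod w >= lam ^ N gives each cylinder a weight at least 1 when
    its word is weighted by prod w / lam ^ N, and the sum of prod w over all
    words of length N is (sum w) ^ N. *)
Lemma heavy_cover_le N : (lebesgue_measure (heavy_cover N) <=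
  (M%:R / (b - 1) * ((\sum_k w k) / (lam * b)) ^+ N)%:E)%E.
Proof.
have c0 : 0 <= M%:R / (b - 1) / b ^+ N.
  by rewrite !divr_ge0 ?exprn_ge0 //; have := b_gt1; lra.
apply: le_trans (measure_bigsetU_le _ _ _) _ => [t _|].
  exact: measurable_itv.
rewrite (eq_bigr (fun=> (M%:R / (b - 1) / b ^+ N)%:E)) => [|t _]; last first.
  rewrite /cylinder /= lebesgue_measure_itv /= lte_fin.
  rewrite -EFinB addrAC subrr add0r.
  case: ltP => // h; congr EFin; apply/eqP; rewrite eq_le c0.
  by move: h; rewrite gerDl => ->.
rewrite sumEFin lee_fin.
have l0 : 0 < lam ^+ N by rewrite exprn_gt0.
apply: (@le_trans _ _ (\sum_(t : 'I_M.+1 ^ N)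
    M%:R / (b - 1) / b ^+ N * (\prod_i w (t i) / lam ^+ N))).
  rewrite big_mkcond ler_sum // => t _; case: ifPn => [h|_].
    by rewrite ler_peMr // ler_pdivlMr // mul1r.
  by rewrite mulr_ge0 // divr_ge0 ?ltW // prodr_gt0.
rewrite -mulr_sumr -mulr_suml -(bigA_distr_bigA (fun=> w)) /=.
rewrite prodr_const card_ord !exprMn exprVn exprMn invfM.
rewrite le_eqVlt; apply/orP; left; apply/eqP; ring.
Qed.

Lemma heavy_cover_null : \sum_k w k < lam * b ->
  lebesgue_measure (lim_sup_set heavy_cover) = 0%E.
Proof.
move=> wlb; apply: lim_sup_set_cvg0; first exact: measurable_heavy_cover.
have b0 : 0 < b by have := b_gt1; lra.
have W0 : 0 < \sum_k w k.
  by rewrite (bigD1 ord0) //= ltr_pwDl // sumr_ge0 // => k _; rewrite ltW.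
set c : R := M%:R / (b - 1); set q : R := (\sum_k w k) / (lam * b).
have q0 : 0 < q by rewrite divr_gt0 ?mulr_gt0.
have q1 : `|q| < 1 by rewrite gtr0_norm // ltr_pdivrMr ?mulr_gt0 // mul1r.
have c0 : 0 <= c by rewrite divr_ge0 //; have := b_gt1; lra.
apply: (@le_lt_trans _ _ (c / (1 - q))%:E); last exact: ltry.
apply: lime_le; first by apply: is_cvg_nneseries.
apply: nearW => N; apply: (@le_trans _ _ (\sum_(0 <= i < N) (c * q ^+ i)%:E)%E).
  by apply: lee_sum => i _; exact: heavy_cover_le.
by rewrite sumEFin lee_fin; exact: (geometric_le_lim N c0 q0 q1).
Qed.

Lemma expansion_in_cylinder N (a : nat -> 'I_M.+1) x : Sigma b x a ->
  cylinder [ffun i : 'I_N => a i] x.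
Proof.
move=> ax; have b1 := b_gt1; have b0 : 0 < b by lra.
pose u := series (fun i => (a i)%:R / b ^+ i.+1).
have valE : word_value [ffun i : 'I_N => a i] = u N.
  rewrite /word_value /u /series /= big_mkord; apply: eq_bigr => i _.
  by rewrite ffunE.
rewrite /cylinder /= in_itv /= valE.
pose c : R := M%:R / (b - 1).
have uS n : u n.+1 = u n + (a n)%:R / b ^+ n.+1.
  by rewrite /u /series /= big_nat_recr.
have u_nd : nondecreasing_seq u.
  apply/nondecreasing_seqP => m; rewrite uS lerDl divr_ge0 //.
  by rewrite exprn_ge0 // (ltW b0).
have v_ni : nonincreasing_seq (fun n => u n + c / b ^+ n).
  apply/nonincreasing_seqP => m; rewrite uS -addrA lerD2l.
  have bn : 0 < b ^+ m.+1 by rewrite exprn_gt0.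
  have -> : c / b ^+ m = (M%:R + c) / b ^+ m.+1.
    have b0' : b != 0 by rewrite gt_eqF.
    have bB : b - 1 != 0 by rewrite subr_eq0 gt_eqF.
    by rewrite /c exprS; field; rewrite bB b0' expf_neq0.
  by rewrite -mulrDl ler_pM2r ?invr_gt0 // lerD2r ler_nat -ltnS.
have c0 n : 0 <= c / b ^+ n.
  by rewrite !divr_ge0 ?exprn_ge0 ?subr_ge0 ?(ltW b1) ?(ltW b0).
apply/andP; split.
  by apply: (cvgr_to_ge ax); exists N => // n /= Nn; exact: u_nd.
apply: (cvgr_to_le ax); exists N => // n /= Nn.
by apply: le_trans (v_ni _ _ Nn); rewrite lerDl.
Qed.

End Cover.

(** If a word of length N has frequencies close to p, then the logarithm of its
    weight is close to N sum_k p_k log w_k.  So an expansion of x with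
    frequencies p puts x in all but finitely many of the heavy covers.  Their
    limit superior is null if lam is chosen between (sum w) / b and
    prod_k w_k ^ p_k. *)
Lemma unattained_frequencies {R : realType} {M : nat} (b : R)
    (p w : 'I_M.+1 -> R) : (0 < M)%N -> 1 < b -> (forall k, 0 < w k) ->
  \sum_k w k < b * expR (\sum_k p k * ln (w k)) ->
  exists2 x, 0 < x < M%:R / (b - 1) & ~ Delta_beta b x p.
Proof.
move=> M0 b1 w0 hw; apply: contrapT => /forall2NP h.
have b0 : 0 < b by lra.
set E := expR _ in hw.
have W0 : 0 < \sum_k w k.
  by rewrite (bigD1 ord0) //= ltr_pwDl // sumr_ge0 // => k _; rewrite ltW.
have [lam /andP[lam1 lam2]] : exists lam, (\sum_k w k) / b < lam < E.
  have h1 : (\sum_k w k) / b < E by rewrite ltr_pdivrMr // mulrC.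
  by exists (((\sum_k w k) / b + E) / 2); lra.
have lam0 : 0 < lam by apply: lt_trans lam1; rewrite divr_gt0.
have null := @heavy_cover_null R M b w lam b1 w0 lam0.
have cM : 0 < M%:R / (b - 1) by rewrite divr_gt0 ?ltr0n ?subr_gt0.
suff sub : `]0, M%:R / (b - 1)[ `<=` lim_sup_set (heavy_cover b w lam).
  have mlim : measurable (lim_sup_set (heavy_cover b w lam)).
    apply: bigcap_measurable => // k _; apply: bigcup_measurable => j _.
    exact: measurable_heavy_cover.
  have : (lebesgue_measure `]0%R, (M%:R / (b - 1))%R[ <=
      lebesgue_measure (lim_sup_set (heavy_cover b w lam)))%E.
    by apply: le_measure => //; rewrite inE //; exact: measurable_itv.
  rewrite null; last by rewrite -ltr_pdivrMr.
  by rewrite lebesgue_measure_itv /= lte_fin cM -EFinB subr0 lee_fin leNgt cM.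
move=> x /=; rewrite in_itv /= => x0.
have [//|/contrapT[_ [a ax af]]] := h x.
have ev := cvgr_ge _ (cvg_freq_mean (v := fun k => ln (w k)) af).
have lnlam : ln lam < \sum_k p k * ln (w k).
  by rewrite -ltr_expR lnK.
have {ev}[N0 _ evN] := ev _ _ lnlam.
move=> N _; exists (maxn N N0).+1; first by rewrite /= ltnW // ltnS leq_maxl.
set n := (maxn N N0).+1.
have /evN : (N0 <= n)%N by rewrite ltnW // ltnS leq_maxr.
rewrite ler_pdivlMr ?ltr0n // => hn.
rewrite /heavy_cover -bigcup_seq_cond.
exists [ffun i : 'I_n => a i]; last exact: expansion_in_cylinder.
rewrite /= mem_index_enum /=.
have -> : \prod_(i < n) w ([ffun i : 'I_n => a i] i) =
    expR (\sum_(i < n) ln (w (a i))).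
  by rewrite expR_sum; apply: eq_bigr => i _; rewrite ffunE lnK // posrE.
have -> : lam ^+ n = expR (ln lam * n%:R) by rewrite expRM_natr lnK.
by rewrite ler_expR.
Qed.

(** The weights are 1 for the digit 0 and e for the digit M, as the frequencies
    1 - e and e suggest, plus a further amount of total e spread over all digits
    to make the weights positive without losing more than a factor
    1 + 2 e <= exp (2 e). *)
Lemma rare_digit_unattained {R : realType} (M n : nat) (b : R) :
  (0 < M)%N -> (0 < n)%N ->
  expR ((ln n.+1%:R + 2) / n.+1%:R) < b ->
  exists2 x, 0 < x < M%:R / (b - 1) &
    ~ (Delta_eps (M := M) (n.+1%:R^-1) `<=` Delta_beta b x).
Proof.
move=> M0 n0; set m : R := n.+1%:R; set e := m^-1 => hb.
have m2 : 2 <= m by rewrite ler_nat.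
have m0 : 0 < m by lra.
have em : e * m = 1 by rewrite mulVf // gt_eqF.
have e0 : 0 < e by rewrite invr_gt0.
have lnm : ln e = - ln m by rewrite lnV.
have lnm0 : 0 <= ln m by rewrite ln_ge0 //; lra.
have b1 : 1 < b.
  by apply: lt_trans hb; rewrite expR_gt1 divr_gt0 //; lra.
pose p (k : 'I_M.+1) : R := (k == ord0)%:R * (1 - e) + (k == ord_max)%:R * e.
pose w (k : 'I_M.+1) : R :=
  (k == ord0)%:R * 1 + (k == ord_max)%:R * e + e / M.+1%:R.
have eM : 0 < e / M.+1%:R by rewrite divr_gt0.
have w_ge k : (k == ord0)%:R * 1 + (k == ord_max)%:R * e < w k.
  by rewrite /w ltrDl.
have w0 k : 0 < w k.
  by apply: le_lt_trans (w_ge k); rewrite addr_ge0 ?mulr_ge0 // ltW.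
have max0 : (ord_max == ord0 :> 'I_M.+1) = false.
  by apply/negbTE; rewrite -val_eqE /= -lt0n.
have sw : \sum_k w k = 1 + 2 * e.
  rewrite !big_split /= !sum_indicator sumr_const card_ord -[_ *+ _]mulr_natr.
  by rewrite divfK //; lra.
have sp : e * - ln m <= \sum_k p k * ln (w k).
  have -> : \sum_k p k * ln (w k) =
      (1 - e) * ln (w ord0) + e * ln (w ord_max).
    rewrite /p; under eq_bigr do rewrite mulrDl -!mulrA.
    by rewrite big_split /= !sum_indicator.
  have e1 : 0 <= 1 - e by nra.
  rewrite -[leLHS]add0r lerD //.
    rewrite mulr_ge0 // ln_ge0 // ltW //; apply: le_lt_trans (w_ge _).
    by rewrite eqxx mul1r lerDl mulr_ge0 // ltW.
  rewrite ler_wpM2l ?(ltW e0) // -lnm ler_ln ?posrE //.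
  apply: ltW; apply: le_lt_trans (w_ge _).
  by rewrite eqxx max0 mul0r add0r mul1r.
have [|x x0 xp] := @unattained_frequencies R M b p w M0 b1 w0.
  apply: (@lt_le_trans _ _ (b * expR (e * - ln m))); last first.
    by rewrite ler_wpM2l ?ler_expR //; lra.
  rewrite sw mulrN expRN -ltr_pdivrMr ?invr_gt0 ?expR_gt0 // invrK.
  apply: le_lt_trans hb.
  apply: (@le_trans _ _ (expR (2 * e) * expR (e * ln m))).
    by rewrite ler_wpM2r ?expR_ge0 ?expR_ge1Dx.
  by rewrite -expRD ler_expR -/e; lra.
exists x => //; apply: contra_not xp; apply.
rewrite /Delta_eps /=; split => [k|].
  have : e <= 1 - e by nra.
  rewrite /p -/m -/e; case: eqP => [->|_].
    by rewrite (eq_sym ord0) max0 /=; lra.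
  by case: (k == ord_max) => /=; lra.
under eq_bigr do rewrite /p.
rewrite big_split /= (sum_indicator _ (fun=> 1 - e)).
by rewrite (sum_indicator _ (fun=> e)); lra.
Qed.

(** * The two-sided estimate *)

(** With h the exponent, e ^ h <= 1 + h + h ^ 2 e ^ h follows by applying
    1 - h <= e ^ (- h) twice.  The last term is O(1 / m): h is at most 2, and
    (log m + 2) ^ 2 <= 2 exp (log m + 2) is a multiple of m. *)
Lemma expR_small_le {R : realType} (m : R) : 2 <= m ->
  expR ((ln m + 2) / m) <= 1 + ln m / m + (2 + 2 * expR 2 ^+ 2) / m.
Proof.
move=> m2; have m0 : 0 < m by lra.
set y := ln m + 2; set h := y / m.
have lnm0 : 0 <= ln m by rewrite ln_ge0 //; lra.
have lnm1 : ln m <= m - 1.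
  by have := @le_ln1Dx R (m - 1); rewrite (addrC 1) subrK; apply; lra.
have y0 : 0 <= y by rewrite /y; lra.
have h0 : 0 <= h by rewrite divr_ge0 ?(ltW m0).
have h2 : h <= 2 by rewrite ler_pdivrMr // /y; lra.
have E2 : 0 < expR (2 : R) by exact: expR_gt0.
have ysq : y ^+ 2 <= 2 * expR 2 * m.
  have := expR_ge1Dxn 1 y0; rewrite /y expRD lnK ?posrE // -/y.
  by rewrite (_ : 2`! = 2)%N //; lra.
have hsq : h ^+ 2 <= 2 * expR 2 / m.
  have -> : h ^+ 2 = y ^+ 2 / m / m by rewrite /h; field; rewrite gt_eqF.
  by rewrite ler_pM2r ?invr_gt0 // ler_pdivrMr.
have Eh : expR h <= expR 2 by rewrite ler_expR.
have step1 : expR h <= 1 + h * expR h.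
  have := @expR_ge1Dx R (- h); rewrite expRN => /(ler_wpM2l (expR_ge0 h)).
  by rewrite divff ?gt_eqF ?expR_gt0 //; lra.
have step2 : expR h <= 1 + h + h ^+ 2 * expR h.
  by have := ler_wpM2l h0 step1; lra.
have : h ^+ 2 * expR h <= 2 * expR 2 / m * expR 2.
  by rewrite ler_pM ?sqr_ge0 ?expR_ge0.
have hE : h = ln m / m + 2 / m by rewrite -mulrDl.
by lra.
Qed.

Theorem theorem1p6 (R : realType) :
  exists C : R, forall M n : nat, (0 < M)%N -> (0 < n)%N ->
    [/\ (3 <= n)%N ->
          1 + (ln n%:R - ln (ln n%:R)) / n%:R < beta_ n :> R,
        beta_ n <= beta_star M n :> R
      & beta_star M n <=
          1 + ln n.+1%:R / n.+1%:R + C * ((1 + ln M%:R) / n.+1%:R) :> R].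
Proof.
exists (2 + 2 * expR 2 ^+ 2) => M n M0 n0.
set A : set R := [set b | forall beta, 1 < beta < b -> forall x,
  0 < x < M%:R / (beta - 1) ->
  Delta_eps (M := M) (n.+1%:R^-1) `<=` Delta_beta beta x].
set eh : R := expR ((ln n.+1%:R + 2) / n.+1%:R).
have ubA : ubound A eh.
  move=> b Ab; rewrite leNgt; apply/negP => hb.
  have eh1 : 1 < eh.
    by rewrite expR_gt1 divr_gt0 // ltr_wpDl // ln_ge0 // ler1n.
  have hc : eh < (eh + b) / 2 by lra.
  have [x x0 []] := rare_digit_unattained M0 n0 hc.
  by apply: Ab x0; lra.
have Abn : A (beta_ n) by move=> b hb x; exact: Delta_eps_attained.
split; first exact: beta_gt_log.
  by apply: ub_le_sup => //; exists eh.
apply: (@le_trans _ _ eh); first by apply: ge_sup => //; exists (beta_ n).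
apply: le_trans (expR_small_le _) _; first by rewrite ler_nat.
rewrite lerD2l mulrA ler_pM2r ?invr_gt0 //.
rewrite ler_peMr ?addr_ge0 ?mulr_ge0 ?sqr_ge0 //.
by rewrite lerDl ln_ge0 // ler1n.
Qed.
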